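(* Let $1\le p\le q\le\infty$ with $(p,q)\ne(1,\infty)$. For $\beta,\gamma\in\mathbb{R}$, there is a constant $C>0$ such that the inequality $\|x^{-\beta}\mathcal{L}f\|_{L_q}\le C\|x^\gamma f\|_{L_p}$ holds for all $f$ if and only if $$\beta<\frac1q\quad\text{and}\quad\beta=\gamma+\frac1q-\frac1{p'},$$ or equivalently, $$\gamma<\frac1{p'}\quad\text{and}\quad\gamma=\beta-\frac1q+\frac1{p'}.$$ Moreover, for $\beta,\gamma\in\mathbb{R}$, there is a constant $C>0$ such that the inequality $\|x^{-\beta}\mathcal{L}f\|_{L_\infty}\le C\|x^\gamma f\|_{L_1}$ holds for all $f$ if and only if $\beta=\gamma$ and $\beta\le0$.
   Context: $\mathcal{L}f(y)=\int_0^\infty f(x)e^{-xy}\,dx$, $y>0$, is the Laplace transform. All norms are over $\mathbb{R}_+=(0,\infty)$ with Lebesgue measure, so $\|x^{-\beta}\mathcal{L}f\|_{L_q}$ is the $L_q(0,\infty)$ norm of $x\mapsto x^{-\beta}\mathcal{L}f(x)$. $p'$ is the Hölder conjugate of $p$ ($\frac1p+\frac1{p'}=1$), and $\frac1\infty=0$. ''For all $f$'' means for all measurable $f$ on $\mathbb{R}_+$ for which the transform is defined, i.e. $f(x)e^{-xy}$ is integrable on compact subsets of $\mathbb{R}_+$ for every $y>0$ and $\lim_{N\to\infty}\int_0^N f(x)e^{-xy}\,dx$ exists and is finite for every $y>0$; the constant $C$ does not depend on $f$. *)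

(* Defs.v *)
From HB Require Import structures.
From mathcomp Require Import all_boot all_order all_algebra.
From mathcomp Require Import all_classical all_reals all_analysis.

Set Implicit Arguments.
Unset Strict Implicit.
Unset Printing Implicit Defensive.

Import Order.TTheory GRing.Theory Num.Theory.
Import numFieldNormedType.Exports.

Local Open Scope classical_set_scope.
Local Open Scope ring_scope.

Section laplace.
Context {R : realType}.
Implicit Types (f : R -> R) (p q : \bar R) (y beta gamma : R).

Local Notation mu := (@lebesgue_measure R).

Definition Rpos : set R := `]0, +oo[.

Definition laplace_trunc f y (N : R) : \bar R :=
  (\int[mu]_(x in `]0%R, N[) (f x * expR (- (x * y)))%:E)%E.

Definition laplace f y : \bar R :=
  lim (laplace_trunc f y N @[N --> +oo]).

(* The integral over ]0, N[ is a Lebesgue integral; the library's value is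
   infinite unless both the positive and the negative part have a finite
   integral (+oo - +oo is -oo), so the convergence to a real number forces
   integrability on every ]0, N[. *)
Definition has_laplace f : Prop :=
  measurable_fun Rpos f /\
  forall y, 0 < y ->
    locally_integrable Rpos (fun x => f x * expR (- (x * y))) /\
    exists l : R, laplace_trunc f y N @[N --> +oo] --> l%:E.

(* The L_p norm over ]0, +oo[: g is extended by 0 to the real line. *)
Definition Lnorm_pos p (g : R -> \bar R) : \bar R :=
  'N[mu]_p[g \_ Rpos]%E.

(* 1/p as a real number, with 1/oo = 0. *)
Definition inv_exp p : R := fine (p^-1)%E.

Definition laplace_ineq p q beta gamma (C : R) f : Prop :=
  (Lnorm_pos q (fun x => (x `^ (- beta))%:E * laplace f x)
   <= C%:E * Lnorm_pos p (fun x => (x `^ gamma * f x)%:E))%E.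

Definition laplace_bounded p q beta gamma : Prop :=
  exists2 C : R, 0 < C &
    forall f, has_laplace f -> laplace_ineq p q beta gamma C f.

End laplace.

(* Main.v *)
Require Import Defs.
From HB Require Import structures.
From mathcomp Require Import all_boot all_order all_algebra.
From mathcomp Require Import all_classical all_reals all_analysis.
From mathcomp Require Import measurable_realfun ess_sup_inf ring lra.

Import Order.TTheory GRing.Theory Num.Theory.
Import numFieldNormedType.Exports.

Local Open Scope classical_set_scope.
Local Open Scope ring_scope.

(** Put [a = 1/q - beta]. When [1/p' - gamma] has the same value, the
    substitution [F x = x^(gamma + 1/p) |f x|],
    [G y = y^(1/q - beta) (L |f|) y] turns the inequality into the bound
    [|G|_q <= C |F|_p] for norms with respect to the dilation-invariant measure
    [dx/x], where

      [G y = \int F x k(x y) dx/x],    [k t = t^a e^{-t}].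

    So the Laplace transform is a multiplicative convolution, and the theorem
    is Young's inequality for the kernel [k], which is integrable for [dt/t]
    if and only if [a > 0], and bounded if and only if [a >= 0].

    Sufficiency. Conditional convergence does no harm since [|L f| <= L |f|].
    As [k] is both integrable and bounded, Young's inequality has a short
    proof: for finite [p], Hoelder's inequality with weight [k] gives [G^p <=
    |k|_1^(p-1) (F^p * k)] ([abs_laplace_jensen]). Bounding [k] by its maximum
    yields [|G|_oo <= D |F|_p] ([abs_laplace_decay]); integrating in [y] and
    exchanging the integrals yields the [L_p] to [L_p] bound
    ([integral_kernel_integral_le]); and [G^q = G^(q-p) G^p] combines the two
    for [p <= q] ([interpolation_powR], [laplace_bounded_finite]). If [p = q =
    oo], the pointwise bound on [F] is integrated directly
    ([laplace_bounded_sup]). For [p = 1] the power of [|k|_1] vanishes, so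
    boundedness of [k] alone suffices for [q = oo]: this is why [a = 0] is
    allowed exactly for [(p, q) = (1, oo)].

    Necessity.  All conditions come from the truncated powers
    [x^(-gamma - 1/p)] on an interval, for which [F] is an indicator function.
    In logarithmic coordinates they turn the inequality into a statement about
    lower bounds of an explicit function on rectangles ([laplace_ineq_box]).
    Translating a unit square along the antidiagonal forces
    [1/q - beta = 1/p' - gamma]; moving it to minus infinity in the first
    coordinate alone forces [a >= 0];
    and if [a = 0], squares of side [z] give [z^(1 + 1/q) <= C z^(1/p)] for
    large [z], which fails unless [p = 1] and [q = oo]. *)

(** * Monotonicity of the integral *)

(** The integral of an arbitrary nonnegative function is a supremum over the
    simple functions below it, hence monotone; this is how norms of
    [laplace f] are estimated. *)
Lemma ge0_le_integral_any d (T : measurableType d) (R : realType)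
    (mu : {measure set T -> \bar R}) (D : set T) (f g : T -> \bar R) :
  (forall x, D x -> 0 <= f x)%E -> (forall x, D x -> f x <= g x)%E ->
  (\int[mu]_(x in D) f x <= \int[mu]_(x in D) g x)%E.
Proof.
move=> f0 fg.
have g0 x : D x -> (0 <= g x)%E by move=> Dx; rewrite (le_trans (f0 x Dx))// fg.
rewrite !ge0_integralE//; apply: le_ereal_sup => _ [h /= hf <-].
exists h => // x; apply: (le_trans (hf x)); rewrite !patchE.
by case: ifPn => //; rewrite inE => /fg.
Qed.

(** * Integrals of powers and the Gamma integral *)

Section power_integrals.
Context {R : realType}.
Local Notation mu := (@lebesgue_measure R).
Implicit Types (a b s t x y : R).

Lemma integral_is_derive (f F : R -> R) s t : s < t ->
  (forall x, s <= x <= t -> is_derive x 1 F (f x)) ->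
  (forall x, s <= x <= t -> {for x, continuous f}) ->
  (\int[mu]_(x in `[s, t]) (f x)%:E = (F t - F s)%:E)%E.
Proof.
move=> st dF cf.
have cF x : s <= x <= t -> {for x, continuous F}.
  move=> /dF [dFx _].
  exact/differentiable_continuous/derivable1_diffP.
have dF' x : s < x < t -> is_derive x 1 F (f x).
  by move=> /andP[sx xt]; apply: dF; rewrite !ltW.
rewrite (@continuous_FTC2 _ f F) ?EFinB//.
- apply: continuous_in_subspaceT => x; rewrite inE/= in_itv/=; exact: cf.
- split.
  + by move=> x; rewrite in_itv/= => /dF'[].
  + by apply: cvg_at_right_filter; apply: cF; rewrite lexx ltW.
  + by apply: cvg_at_left_filter; apply: cF; rewrite lexx ltW.
- by move=> x; rewrite in_itv/= => /dF'[dx <-]; rewrite derive1E.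
Qed.

Lemma integral_mul_inv (m s t : R) : 0 < s -> s < t ->
  (\int[mu]_(x in `[s, t]) (m * x^-1)%:E = (m * (ln t - ln s))%:E)%E.
Proof.
move=> s0 st.
have pos x : s <= x <= t -> 0 < x by move=> /andP[sx _]; exact: lt_le_trans sx.
rewrite mulrBr.
apply: (@integral_is_derive _ (fun x => m * ln x)) => // x /pos x0.
  exact: (@is_deriveZ _ _ _ (@ln R) m x 1 _ (is_derive1_ln x0)).
apply: continuousM; first exact: cvg_cst.
by apply: inv_continuous; rewrite gt_eqF.
Qed.

Lemma measurable_Rpos : measurable (@Rpos R).
Proof. exact: measurable_itv. Qed.

(** Compact subintervals suffice, which keeps singularities at [0] and
    integration up to infinity away from the fundamental theorem of calculus. *)
Lemma ge0_integral_Rpos_le (h : R -> \bar R) (K : \bar R) :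
  measurable_fun (@Rpos R) h -> (forall x, 0 < x -> (0 <= h x)%E) ->
  (forall s t, 0 < s -> s < t -> (\int[mu]_(x in `[s, t]) h x <= K)%E) ->
  (\int[mu]_(x in Rpos) h x <= K)%E.
Proof.
move=> mh h0 hK.
(* [n + 2] rather than [n + 1] makes every interval nondegenerate. *)
pose F n : set R := `[n.+2%:R^-1, n.+2%:R]%classic.
have F0 n x : F n x -> 0 < x.
  by rewrite /F/= in_itv/= => /andP[/lt_le_trans + _]; apply; rewrite invr_gt0.
have -> : @Rpos R = \bigcup_i F i.
  apply/seteqP; split => [x|x [n _ /F0 x0]]; rewrite /Rpos/= in_itv/= andbT//.
  move=> x0; exists (Num.truncn (x + x^-1))%N => //; rewrite /F/= in_itv/=.
  have := truncnS_gt (x + x^-1).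
  set N := Num.truncn _ => xN.
  have xi0 : 0 < x^-1 by rewrite invr_gt0.
  have N2 : N.+1%:R <= N.+2%:R :> R by rewrite ler_nat.
  apply/andP; split; last by lra.
  by rewrite invf_ple ?posrE//; lra.
have mF i : measurable (F i) by exact: measurable_itv.
have FR i : F i `<=` @Rpos R.
  by move=> x /F0 x0; rewrite /Rpos/= in_itv/= x0.
have nF : nondecreasing_seq F.
  apply/nondecreasing_seqP => n; rewrite subsetEset /F => x/=.
  rewrite !in_itv/= => /andP[nx xn]; apply/andP; split.
    by apply: le_trans nx; rewrite lef_pV2 ?posrE// ler_nat.
  by apply: (le_trans xn); rewrite ler_nat.
have hc : (\int[mu]_(x in F i) h x @[i --> \oo]
    --> \int[mu]_(x in \bigcup_i F i) h x)%E.
  apply: ge0_nondecreasing_set_cvg_integral => // [i|i x /F0]; last exact: h0.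
  by apply: (measurable_funS _ (FR i) mh); exact: measurable_Rpos.
rewrite -(cvg_lim _ hc)//; apply: lime_le.
  by apply/cvg_ex; eexists; exact: hc.
apply: nearW => n; apply: hK; first by rewrite invr_gt0.
by rewrite (@lt_trans _ _ 1)// ?invf_lt1// ltr1n.
Qed.

(** From [t/b <= e^(t/b)], raised to the power [b]. *)
Lemma powR_le_expR b t : 0 < b -> 0 <= t -> t `^ b <= b `^ b * expR t.
Proof.
move=> b0 t0; have tb : t = b * (t / b) by rewrite mulrCA divff ?gt_eqF// mulr1.
have tb0 : 0 <= t / b by rewrite divr_ge0// ltW.
rewrite {1}tb powRM// ?(ltW b0)// ler_wpM2l ?powR_ge0//.
apply: (@le_trans _ _ (expR (t / b) `^ b)).
  rewrite ge0_ler_powR ?nnegrE ?(ltW b0) ?expR_ge0//.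
  by rewrite (le_trans _ (expR_ge1Dx _))// lerDr.
by rewrite -expRM divfK ?gt_eqF.
Qed.

Lemma continuous_powR_gt0 (c x : R) : 0 < x ->
  {for x, continuous (fun z : R => z `^ c)}.
Proof.
move=> x0; apply/differentiable_continuous/derivable1_diffP.
by apply: derivable_powR; rewrite in_itv/= x0.
Qed.

Lemma measurable_expMr y : measurable_fun setT (fun x => expR (- (x * y))).
Proof.
by apply: measurableT_comp => //; apply: measurableT_comp => //;
  exact: measurable_funM.
Qed.

(** The exact value is [Gamma a * y^(-a)], but only finiteness and the
    homogeneity in [y] matter.  Since [e^(-t)] is at most a constant times
    [(1 + t)^(-(a+1))], the integrand is dominated by the derivative of the
    bounded function [(x / (1 + x y))^a / a], so no change of variables is
    needed. *)
Lemma gamma_integral_le a : 0 < a -> exists2 K : R, 0 < K & forall y, 0 < y ->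
  (\int[mu]_(x in Rpos) (x `^ (a - 1) * expR (- (x * y)))%:E
    <= (K * y `^ (- a))%:E)%E.
Proof.
move=> a0; pose b := a + 1; pose M : R := b `^ b * expR 1.
have b0 : 0 < b by rewrite /b; lra.
have M0 : 0 < M by rewrite mulr_gt0 ?powR_gt0 ?expR_gt0.
exists (M / a) => [|y y0]; first by rewrite divr_gt0.
have yx1 x : 0 < x -> 0 < 1 + x * y by move=> x0; rewrite addr_gt0// mulr_gt0.
apply: ge0_integral_Rpos_le => [|x x0|s t s0 st].
- apply/measurable_EFinP; apply: measurable_funM => //.
    exact: measurable_funTS.
  by apply: measurable_funTS; exact: measurable_expMr.
- by rewrite lee_fin mulr_ge0 ?powR_ge0 ?expR_ge0.
pose g x : R := x `^ (a - 1) * (1 + x * y) `^ (- b).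
pose G x : R := a^-1 * (x `^ a * (1 + x * y) `^ (- a)).
have pos x : s <= x <= t -> 0 < x.
  by move=> /andP[sx _]; exact: lt_le_trans sx.
have dG x : s <= x <= t -> is_derive x 1 G (g x).
  move=> /pos x0; have := yx1 _ x0 => y1.
  have d1 : is_derive x 1 (fun x : R => x `^ a) (a * x `^ (a - 1)).
    exact: is_derive1_powR.
  have d2 : is_derive x 1 (fun x : R => (1 + x * y) `^ (- a))
      (- a * (1 + x * y) `^ (- a - 1) * y).
    have d21 : is_derive x 1 (fun x : R => 1 + x * y) y.
      have -> : (fun x : R => 1 + x * y) = cst 1 + (y \*: id).
        by apply/funext => z; rewrite /= mulrC.
      by apply: is_derive_eq; rewrite add0r /GRing.scale/= mulr1.
    have d22 := @is_derive1_powR R (- a) _ y1.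
    exact: (@is_derive1_comp _ _ (fun x : R => 1 + x * y) _ _ _ d22 d21).
  have -> : G = a^-1 \*: ((fun x : R => x `^ a)
      * (fun x : R => (1 + x * y) `^ (- a))) by [].
  apply: is_derive_eq; rewrite /g.
  rewrite /GRing.scale/=.
  have -> : - b = - a - 1 by rewrite /b; ring.
  have -> : x `^ a = x `^ (a - 1) * x.
    by rewrite mulrC mulr_powRB1// ltW.
  have -> : (1 + x * y) `^ (- a) = (1 + x * y) `^ (- a - 1) * (1 + x * y).
    rewrite -{1}(subrK 1 (- a)) powRD; last by rewrite (gt_eqF y1) implybT.
    by rewrite powRr1// ltW.
  by field; rewrite gt_eqF.
have cg x : s <= x <= t -> {for x, continuous g}.
  move=> /pos x0; have := yx1 _ x0 => y1; rewrite /g.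
  apply: continuousM; first exact: continuous_powR_gt0.
  apply: (@continuous_comp _ _ _ (fun x : R => 1 + x * y)
    (fun x : R => x `^ (- b))); last exact: continuous_powR_gt0.
  by apply: cvgD; [exact: cvg_cst|apply: cvgM; [exact: cvg_id|exact: cvg_cst]].
apply: (@le_trans _ _ (\int[mu]_(x in `[s, t]) (M%:E * (g x)%:E))%E).
  apply: ge0_le_integral_any => x; rewrite /= in_itv/= => xst.
    by rewrite lee_fin mulr_ge0 ?powR_ge0 ?expR_ge0.
  have x0 := pos _ xst; have := yx1 _ x0 => y1.
  rewrite lee_fin /g mulrCA ler_wpM2l ?powR_ge0//.
  rewrite expRN powRN -lef_pV2 ?posrE ?invr_gt0 ?expR_gt0//; last first.
    by rewrite divr_gt0 ?powR_gt0.
  rewrite invf_div invrK ler_pdivrMr//.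
  by rewrite /M mulrCA -expRD addrC (addrC (_ * _)) powR_le_expR// ltW.
rewrite ge0_integralZl//; last first.
- by rewrite lee_fin ltW.
- by move=> x _; rewrite lee_fin mulr_ge0 ?powR_ge0.
- apply/measurable_EFinP; apply: measurable_funTS; apply: measurable_funM => //.
  apply: (measurableT_comp (measurable_powR _)) => //.
  by apply: measurable_funD => //; exact: measurable_funM.
rewrite (integral_is_derive g G)// -EFinM lee_fin -mulrA ler_wpM2l ?(ltW M0)//.
have t0 : 0 < t by exact: lt_trans st.
rewrite /G -mulrBr ler_wpM2l ?invr_ge0 ?(ltW a0)//.
apply: (@le_trans _ _ (t `^ a * (1 + t * y) `^ (- a))).
  by rewrite gerBl mulr_ge0 ?powR_ge0.
rewrite !powRN ler_pdivrMr ?powR_gt0 ?yx1//.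
rewrite ler_pdivlMl ?powR_gt0//.
rewrite mulrC -powRM ?(ltW y0) ?(ltW t0)//.
rewrite ge0_ler_powR ?nnegrE ?(ltW a0)// ?mulr_ge0 ?(ltW y0) ?(ltW t0)//.
  by rewrite ltW// yx1.
by rewrite lerDr.
Qed.

End power_integrals.

(** * Weighted norms on the half-line *)

Section norms.
Context {R : realType}.
Local Notation mu := (@lebesgue_measure R).
Implicit Types (p q : \bar R) (r s t x y : R).

Lemma inv_expE r : r != 0 -> inv_exp r%:E = r^-1.
Proof. by move=> r0; rewrite /inv_exp inver (negbTE r0). Qed.

Lemma inv_expy : inv_exp (+oo%E : \bar R) = 0.
Proof. by rewrite /inv_exp invey. Qed.

Lemma inv_exp_hoelder_conjugate p : (1 <= p)%E ->
  inv_exp (hoelder_conjugate p) = 1 - inv_exp p.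
Proof.
move=> p1; have p0 : (0 < p)%E by exact: lt_le_trans p1.
have pn0 : p != 0%E by rewrite gt_eqF.
have := @hoelder_conjugate_eq1 R p (lt_trans ltNy0 p0) pn0.
have := hoelder_conj_ge1 p1; rewrite /inv_exp.
move: (hoelder_conjugate p) => p' p'1.
have p'0 : (0 < p')%E by exact: lt_le_trans p'1.
have finV (z : \bar R) : (0 < z)%E -> z^-1%E \is a fin_num.
  case: z => [z|_|//]; last by rewrite invey.
  by rewrite lte_fin => z0; rewrite inver gt_eqF.
move=> /(congr1 fine); rewrite fineD ?finV//= => <-.
by rewrite addrC addKr.
Qed.

Lemma Lnorm_posE r (g : R -> \bar R) : 0 < r ->
  Lnorm_pos r%:E g =
    (((\int[mu]_(x in Rpos) (`|g x| `^ r)) `^ r^-1)%E : \bar R).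
Proof.
move=> r0; rewrite /Lnorm_pos unlock; congr (_ `^ _)%E.
rewrite [RHS]integral_mkcond; apply: eq_integral => x _; rewrite !patchE.
by case: ifPn => // _; rewrite abse0 poweR0r// gt_eqF.
Qed.

Lemma Lnorm_posyP (g : R -> \bar R) (y : \bar R) :
  (Lnorm_pos +oo g <= y)%E <->
  (\forall x \ae mu, `|(g \_ Rpos) x| <= y)%E.
Proof.
have muT : (0 < mu setT)%E.
  by rewrite -set_itvNyy lebesgue_measure_itv/= addye.
rewrite /Lnorm_pos unlock muT; split; last by move/ess_supP.
by move=> h; apply/ess_supP.
Qed.

Lemma itv_Rpos s t x : 0 < s -> s <= x <= t -> x \in @Rpos R.
Proof.
by move=> s0 /andP[sx _]; rewrite inE /Rpos/= in_itv/= andbT (lt_le_trans s0).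
Qed.

(** The function [x^(-1/q)] is the one whose [L_q] norm over [[s, t]] only
    depends on [t/s]; using it makes finite and infinite exponents
    uniform. *)
Lemma Lnorm_pos_ge q (g : R -> \bar R) s t m : (1 <= q)%E ->
    0 < s -> s < t -> 0 <= m ->
    (forall x, s <= x <= t -> ((m * x `^ (- inv_exp q))%:E <= `|g x|)%E) ->
  ((m * (ln t - ln s) `^ inv_exp q)%:E <= Lnorm_pos q g)%E.
Proof.
move=> q1 s0 st m0 gm.
have lnst : 0 < ln t - ln s by rewrite subr_gt0 ltr_ln ?posrE// (lt_trans s0).
case: q q1 gm => [r| |//].
  rewrite lee_fin => r1; have r0 : 0 < r by lra.
  rewrite inv_expE ?gt_eqF// => gm; rewrite Lnorm_posE//.
  have -> : m * (ln t - ln s) `^ r^-1 = (m `^ r * (ln t - ln s)) `^ r^-1.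
    rewrite powRM ?powR_ge0 ?(ltW lnst)// -powRrM divff ?gt_eqF//.
    by rewrite powRr1.
  rewrite -poweR_EFin; apply: gt0_ler_poweR.
  - by rewrite invr_ge0 ltW.
  - by rewrite in_itv/= leey andbT lee_fin mulr_ge0 ?powR_ge0 ?ltW.
  - rewrite in_itv/= leey andbT; apply: integral_ge0 => x _.
    exact: poweR_ge0.
  rewrite -(integral_mul_inv _ _ _ s0 st).
  rewrite integral_mkcond [leRHS]integral_mkcond.
  apply: ge0_le_integral_any => x _; rewrite !patchE.
    case: ifPn => //; rewrite inE/= in_itv/= => /andP[sx _].
    by rewrite lee_fin mulr_ge0 ?powR_ge0// invr_ge0 (le_trans (ltW s0)).
  case: ifPn => [|_]; last by case: ifPn => // _; exact: poweR_ge0.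
  rewrite inE/= in_itv/= => xst; rewrite (itv_Rpos _ _ _ s0 xst).
  have x0 : 0 < x by move: xst => /andP[/(lt_le_trans s0)].
  have -> : m `^ r * x^-1 = (m * x `^ (- r^-1)) `^ r.
    rewrite powRM ?powR_ge0// -powRrM mulNr mulVf ?gt_eqF//.
    by rewrite powR_inv1// ltW.
  rewrite -poweR_EFin; apply: gt0_ler_poweR.
  - exact: ltW.
  - by rewrite in_itv/= leey andbT lee_fin mulr_ge0 ?powR_ge0.
  - by rewrite in_itv/= leey andbT abse_ge0.
  - exact: gm.
rewrite inv_expy powRr0 mulr1 => _ gm; rewrite leNgt; apply/negP => gltm.
have [N [mN N0 gN]] := (Lnorm_posyP g (Lnorm_pos +oo g)).1 (lexx _).
have : (mu `[s, t] <= mu N)%E.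
  apply: le_measure; rewrite ?inE//.
  move=> x /=; rewrite in_itv/= => xst; apply: gN => /= gx.
  move: gx; rewrite patchE (itv_Rpos _ _ _ s0 xst); apply/negP; rewrite -ltNge.
  apply: (lt_le_trans gltm); have := gm x xst.
  by rewrite oppr0 powRr0 mulr1.
by rewrite N0 lebesgue_measure_itv/= lte_fin st -EFinD lee_fin; lra.
Qed.

Lemma Lnorm_pos_le p (g : R -> \bar R) s t : (1 <= p)%E ->
    0 < s -> s < t ->
    (forall x, s <= x <= t -> (`|g x| <= (x `^ (- inv_exp p))%:E)%E) ->
    (forall x, 0 < x -> ~~ (s <= x <= t) -> g x = 0%E) ->
  (Lnorm_pos p g <= ((ln t - ln s) `^ inv_exp p)%:E)%E.
Proof.
move=> p1 s0 st gle g0.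
have lnst : 0 < ln t - ln s by rewrite subr_gt0 ltr_ln ?posrE// (lt_trans s0).
have Rpos_gt0 x : x \in @Rpos R -> 0 < x.
  by rewrite inE /Rpos/= in_itv/= andbT.
case: p p1 gle => [r| |//].
  rewrite lee_fin => r1; have r0 : 0 < r by lra.
  rewrite inv_expE ?gt_eqF// => gle; rewrite Lnorm_posE// -poweR_EFin.
  apply: gt0_ler_poweR.
  - by rewrite invr_ge0 ltW.
  - rewrite in_itv/= leey andbT; apply: integral_ge0 => x _.
    exact: poweR_ge0.
  - by rewrite in_itv/= leey andbT lee_fin ltW.
  rewrite -[X in X%:E]mul1r -(integral_mul_inv _ _ _ s0 st).
  rewrite integral_mkcond [leRHS]integral_mkcond.
  apply: ge0_le_integral_any => x _; rewrite !patchE.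
    by case: ifPn => // _; exact: poweR_ge0.
  case: ifPn => [/Rpos_gt0 x0|xn].
    case: ifPn; last first.
      rewrite notin_setE/= in_itv/= => /negP xst.
      by rewrite (g0 _ x0 xst) abse0 poweR0r// gt_eqF.
    rewrite inE/= in_itv/= => xst.
    have -> : 1 * x^-1 = (x `^ (- r^-1)) `^ r.
      by rewrite -powRrM mulNr mulVf ?gt_eqF// powR_inv1 ?mul1r// ltW.
    rewrite -poweR_EFin; apply: gt0_ler_poweR.
    - exact: ltW.
    - by rewrite in_itv/= leey andbT abse_ge0.
    - by rewrite in_itv/= leey andbT lee_fin powR_ge0.
    - exact: gle.
  case: ifPn => //; rewrite inE/= in_itv/= => /(itv_Rpos _ _ _ s0).
  by rewrite (negbTE xn).
rewrite inv_expy powRr0 oppr0 => _ gle.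
apply/Lnorm_posyP; apply: nearW => x; rewrite patchE.
case: ifPn => [/Rpos_gt0 x0|_]; last by rewrite abse0 lee_fin.
have [/gle|xst] := boolP (s <= x <= t); first by rewrite powRr0.
by rewrite (g0 _ x0 xst) abse0 lee_fin.
Qed.

End norms.

(** * Necessity: truncated powers as test functions *)

Section necessity.
Context {R : realType}.
Local Notation mu := (@lebesgue_measure R).
Implicit Types (p q : \bar R) (c s t x y : R).

Definition power_on c s t : R -> R := (fun x => x `^ c) \_ `[s, t].

Lemma power_on_expE c s t y :
  (fun x => power_on c s t x * expR (- (x * y))) =
  (fun x => x `^ c * expR (- (x * y))) \_ `[s, t].
Proof.
apply/funext => x; rewrite /power_on !patchE.
by case: ifPn; rewrite ?mul0r.
Qed.

Lemma integrable_power_exp c s t y : 0 < s ->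
  mu.-integrable `[s, t] (EFin \o (fun x => x `^ c * expR (- (x * y)))).
Proof.
move=> s0; apply: continuous_compact_integrable; first exact: segment_compact.
apply: continuous_in_subspaceT => x; rewrite inE/= in_itv/= => /andP[sx _].
have x0 : 0 < x by exact: lt_le_trans sx.
have cp : {for x, continuous (fun z : R => z `^ c)}.
  exact: continuous_powR_gt0.
have ce : {for x, continuous (fun z : R => expR (- (z * y)))}.
  apply: (@continuous_comp _ _ _ (fun z : R => - (z * y)) expR).
    by apply: cvgN; apply: cvgM; [exact: cvg_id|exact: cvg_cst].
  exact: continuous_expR.
exact: (@continuousM _ _ _ _ x cp ce).
Qed.

Lemma laplace_power_on c s t : 0 < s -> s < t ->
  has_laplace (power_on c s t) /\
  forall y, 0 < y -> laplace (power_on c s t) y =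
    (\int[mu]_(x in `[s, t]) (x `^ c * expR (- (x * y)))%:E)%E.
Proof.
move=> s0 st.
have sub : `[s, t]%classic `<=` @Rpos R.
  by move=> x /=; rewrite in_itv/= => /(itv_Rpos _ _ _ s0); rewrite inE.
have cvgI y : laplace_trunc (power_on c s t) y N @[N --> +oo] -->
    (\int[mu]_(x in `[s, t]) (x `^ c * expR (- (x * y)))%:E)%E.
  apply: cvg_near_cst; near=> N.
  rewrite /laplace_trunc.
  under eq_integral do rewrite (congr1 (@^~ _) (power_on_expE c s t y)).
  have -> :
      (fun x => ((((fun x => x `^ c * expR (- (x * y))) \_ `[s, t]) x)%:E))
     = (fun x => (x `^ c * expR (- (x * y)))%:E) \_ `[s, t].
    by apply/funext => x; rewrite !patchE; case: ifP.
  rewrite -integral_mkcondr setIidr// => x /=.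
  rewrite !in_itv/= => /andP[sx xt].
  rewrite (lt_le_trans s0 sx)/= (le_lt_trans xt)//.
  by near: N; apply: nbhs_pinfty_gt; exact: num_real.
split; last first.
  by move=> y y0; rewrite /laplace; apply/cvg_lim => //; exact: cvgI.
split.
  rewrite /power_on; apply: measurable_funTS.
  apply/(measurable_restrictT _ _).1; first exact: measurable_itv.
  exact: measurable_funTS.
move=> y y0; split.
  apply: open_integrable_locally; first exact: interval_open.
  rewrite power_on_expE -restrict_EFin; apply/integrable_restrict => //=.
    exact: measurable_Rpos.
  by rewrite setIidr//; exact: integrable_power_exp.
exists (fine (\int[mu]_(x in `[s, t]) (x `^ c * expR (- (x * y)))%:E)%E).
rewrite fineK; first exact: cvgI.
by apply: integrable_fin_num => //; exact: integrable_power_exp.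
Unshelve. all: by end_near. Qed.

(** The test function is [x^(a' - 1)] on [[e^sigma, e^sigma']], the exponent
    being chosen so that [x^gamma f x = x^(-1/p)].  With [x = e^xi] and
    [y = e^eta], the exponential in the hypothesis is [y^a x^a' e^(-x y)]; a
    lower bound [m] for it gives
    [y^(-beta) L f y >= m (sigma' - sigma) y^(-1/q)] on [[e^tau, e^tau']]. *)
Lemma laplace_ineq_box p q beta gamma C (sigma sigma' tau tau' m : R)
    (a := inv_exp q - beta) (a' := 1 - inv_exp p - gamma) :
  0 <= C -> (1 <= p)%E -> (1 <= q)%E ->
  sigma < sigma' -> tau < tau' -> 0 <= m ->
  (forall xi eta, sigma <= xi <= sigma' -> tau <= eta <= tau' ->
     m <= expR (a * eta + a' * xi - expR (xi + eta))) ->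
  (forall f, has_laplace f -> laplace_ineq p q beta gamma C f) ->
  m * (sigma' - sigma) * (tau' - tau) `^ inv_exp q
    <= C * (sigma' - sigma) `^ inv_exp p.
Proof.
move=> C0 p1 q1 ss tt m0 hm hC.
pose s := expR sigma; pose t := expR sigma'.
pose u := expR tau; pose v := expR tau'.
have s0 : 0 < s by exact: expR_gt0.
have u0 : 0 < u by exact: expR_gt0.
have st : s < t by rewrite ltr_expR.
have uv : u < v by rewrite ltr_expR.
have [hL LE] := laplace_power_on (a' - 1) _ _ s0 st.
have := hC _ hL; rewrite /laplace_ineq => hineq.
have lnE : ln t - ln s = sigma' - sigma by rewrite /s /t !expRK.
have lnE' : ln v - ln u = tau' - tau by rewrite /u /v !expRK.
have hle : (Lnorm_pos p (fun x => (x `^ gamma * power_on (a' - 1) s t x)%:E)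
    <= ((sigma' - sigma) `^ inv_exp p)%:E)%E.
  rewrite -lnE; apply: Lnorm_pos_le => // x.
    move=> xst; rewrite /power_on patchE.
    have x0 : 0 < x by move: xst => /andP[/(lt_le_trans s0)].
    rewrite mem_set; last by rewrite /= in_itv.
    rewrite -powRD; last by rewrite (gt_eqF x0) implybT.
    rewrite lee_fin ger0_norm ?powR_ge0//.
    rewrite le_eqVlt; apply/orP; left; apply/eqP; congr (_ `^ _).
    by rewrite /a'; ring.
  move=> x0 xst; rewrite /power_on patchE memNset ?mulr0//.
  by rewrite /= in_itv/=; exact/negP.
rewrite -lee_fin [leRHS]EFinM.
apply: (@le_trans _ _ (C%:E * Lnorm_pos p
    (fun x => (x `^ gamma * power_on (a' - 1) s t x)%:E))%E); last first.
  by apply: lee_wpmul2l; rewrite ?lee_fin.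
apply: le_trans hineq; rewrite -lnE'.
have mln0 : 0 <= m * (sigma' - sigma) by rewrite mulr_ge0// subr_ge0 ltW.
apply: Lnorm_pos_ge => // y yuv.
have y0 : 0 < y by move: yuv => /andP[/(lt_le_trans u0)].
have yE : expR (ln y) = y by rewrite lnK.
have etauv : tau <= ln y <= tau'.
  by rewrite -ler_expR -(ler_expR _ tau') yE.
rewrite LE// abseM/= ger0_norm ?powR_ge0//.
apply: (@le_trans _ _
    ((y `^ (- beta))%:E * (m * y `^ (- a) * (sigma' - sigma))%:E)%E).
  rewrite -EFinM lee_fin le_eqVlt; apply/orP; left; apply/eqP.
  have -> : - inv_exp q = - beta + - a by rewrite /a; ring.
  by rewrite powRD ?(gt_eqF y0) ?implybT//; ring.
apply: lee_wpmul2l; first by rewrite lee_fin powR_ge0.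
rewrite -lnE -(integral_mul_inv _ _ _ s0 st).
rewrite gee0_abs; last first.
  by apply: integral_ge0 => x _; rewrite lee_fin mulr_ge0 ?powR_ge0 ?expR_ge0.
apply: ge0_le_integral_any => x; rewrite /= in_itv/= => xst.
  have x0 : 0 < x by move: xst => /andP[/(lt_le_trans s0)].
  by rewrite lee_fin !mulr_ge0 ?powR_ge0// invr_ge0 ltW.
have x0 : 0 < x by move: xst => /andP[/(lt_le_trans s0)].
have xE : expR (ln x) = x by rewrite lnK.
have xist : sigma <= ln x <= sigma'.
  by rewrite -ler_expR -(ler_expR _ sigma') xE.
have := hm _ _ xist etauv.
rewrite expRD expRN expRD yE xE expRD => hmx.
rewrite lee_fin powRB ?(gt_eqF x0) ?implybT// powRr1 ?(ltW x0)//.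
rewrite powRN [leRHS]mulrAC ler_wpM2r ?invr_ge0 ?(ltW x0)//.
rewrite ler_pdivrMr ?powR_gt0//; apply: (le_trans hmx).
rewrite /powR (gt_eqF x0) (gt_eqF y0) expRN.
by rewrite -mulrA mulrC.
Qed.

Lemma affine_bounded_slope0 (d B : R) :
  (forall z, d * z <= B) -> d = 0.
Proof.
move=> dB; apply/eqP; apply: contraT => d0.
have := dB ((B + 1) / d); rewrite mulrCA divff// mulr1; lra.
Qed.

Lemma expR_bounded_above (d B : R) : 0 < d ->
  ~ (forall z, 0 <= z -> expR (d * z) <= B).
Proof.
move=> d0 dB.
have B0 : 0 < B by apply: lt_le_trans (dB 0 (lexx _)); exact: expR_gt0.
have := dB (B / d) (divr_ge0 (ltW B0) (ltW d0)).
rewrite mulrCA divff ?gt_eqF// mulr1 => h.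
by have := expR_ge1Dx B; lra.
Qed.

(** Dilation invariance: on the squares [z <= xi <= z + 1],
    [- z - 1 <= eta <= - z] the sum [xi + eta] stays bounded, so that the
    minimum of the kernel is of order [e^((a' - a) z)], while both logarithmic
    lengths are [1].  It can stay bounded for all [z] only if [a' = a]. *)
Lemma laplace_bounded_scaling p q beta gamma : (1 <= p)%E -> (1 <= q)%E ->
  laplace_bounded p q beta gamma ->
  inv_exp q - beta = 1 - inv_exp p - gamma.
Proof.
move=> p1 q1 [C C0 hC].
set a := inv_exp q - beta; set a' := 1 - inv_exp p - gamma.
pose K := `|a| + `|a'| + expR 1.
apply/eqP; rewrite eq_sym -subr_eq0; apply/eqP.
apply: (@affine_bounded_slope0 _ (C + K)) => z.
have := @laplace_ineq_box p q beta gamma C z (z + 1) (- z - 1) (- z)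
  (expR ((a' - a) * z - K)) (ltW C0) p1 q1 _ _ (expR_ge0 _) _ hC.
have -> : z + 1 - z = 1 by ring.
have -> : - z - (- z - 1) = 1 by ring.
rewrite !powR1 !mulr1 => h.
have {}h : expR ((a' - a) * z - K) <= C.
  apply: h => [||xi eta xiz etaz]; [lra|lra|].
  rewrite ler_expR -/a -/a'.
  have hxe : expR (xi + eta) <= expR 1 by rewrite ler_expR; lra.
  have := ler_norm (a * (- eta - z)); have := ler_norm (- a' * (xi - z)).
  rewrite !normrM !normrN.
  have xi1 : `|xi - z| <= 1 by rewrite ler_norml; lra.
  have eta1 : `|- eta - z| <= 1 by rewrite ler_norml; lra.
  have := ler_wpM2l (normr_ge0 a) eta1; have := ler_wpM2l (normr_ge0 a') xi1.
  rewrite !mulr1 /K; lra.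
by have := expR_ge1Dx ((a' - a) * z - K); lra.
Qed.

(** If [a < 0], the kernel [(x y)^a e^(-x y)] is unbounded as [x y] tends to
    [0], which is reached by sending [xi] to minus infinity. *)
Lemma laplace_bounded_beta_le p q beta gamma : (1 <= p)%E -> (1 <= q)%E ->
  laplace_bounded p q beta gamma -> beta <= inv_exp q.
Proof.
move=> p1 q1 bpq; have := laplace_bounded_scaling _ _ _ _ p1 q1 bpq.
move: bpq => [C C0 hC] aE.
rewrite leNgt; apply/negP => qb.
have a0 : 0 < beta - inv_exp q by lra.
apply: (@expR_bounded_above _ (C * expR 1) a0) => z z0.
have := @laplace_ineq_box p q beta gamma C (- z - 1) (- z) (- 1) 0
  (expR ((beta - inv_exp q) * z - 1)) (ltW C0) p1 q1 _ _ (expR_ge0 _) _ hC.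
have -> : - z - (- z - 1) = 1 by ring.
rewrite opprK add0r !powR1 !mulr1 => h.
rewrite -ler_pdivrMr ?expR_gt0// -expRB.
apply: h => [||xi eta xiz etaz]; [lra|lra|].
rewrite ler_expR -aE.
have hxe : expR (xi + eta) <= 1 by rewrite -expR0 ler_expR; lra.
nra.
Qed.

(** If [a = 0], the kernel [e^(-x y)] is at least [1/e] for [x, y <= 1]; squares
    of side [l] then give [l * l^(1/q) <= C e l^(1/p)].  Taking [l = e^z] turns
    powers into exponentials. *)
Lemma laplace_bounded_beta_lt p q beta gamma : (1 <= p)%E -> (1 <= q)%E ->
  inv_exp p < 1 + inv_exp q ->
  laplace_bounded p q beta gamma -> beta < inv_exp q.
Proof.
move=> p1 q1 pq bpq; have := laplace_bounded_scaling _ _ _ _ p1 q1 bpq.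
have := laplace_bounded_beta_le _ _ _ _ p1 q1 bpq.
rewrite le_eqVlt => /predU1P[bq|//].
rewrite -bq subrr => /esym a'0; exfalso.
move: bpq => [C C0 hC].
have d0 : 0 < 1 + inv_exp q - inv_exp p by lra.
apply: (@expR_bounded_above _ (C * expR 1) d0) => z z0.
have ez := expR_gt0 z.
have := @laplace_ineq_box p q beta gamma C (- expR z) 0 (- expR z) 0
  (expR (- 1)) (ltW C0) p1 q1 _ _ (expR_ge0 _) _ hC.
rewrite !opprK !add0r -!expRM => h.
have {}h : expR (- 1) * expR z * expR (z * inv_exp q)
    <= C * expR (z * inv_exp p).
  apply: h => [||xi eta xiz etaz]; [lra|lra|].
  rewrite ler_expR bq subrr a'0 !mul0r !add0r lerN2.
  by rewrite -expR0 ler_expR; lra.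
rewrite mulrBl mulrDl mul1r expRB expRD ler_pdivrMr ?expR_gt0//.
rewrite (mulrC _ z) (mulrC _ z).
have := ler_wpM2l (expR_ge0 1) h.
have e1 : expR 1 * expR (- 1) = 1 :> R by rewrite -expRD subrr expR0.
by rewrite !mulrA e1 mul1r (mulrC _ C).
Qed.

End necessity.

(** * Hoelder and Tonelli estimates for the kernel *)

Section kernel.
Context {R : realType}.
Local Notation mu := (@lebesgue_measure R).
Implicit Types (p q : \bar R) (a r x y : R) (f h H : R -> R).

Lemma RposP x : @Rpos R x <-> 0 < x.
Proof. by rewrite /Rpos/= in_itv/= andbT. Qed.

Definition abs_laplace f y : \bar R :=
  (\int[mu]_(x in Rpos) (`|f x| * expR (- (x * y)))%:E)%E.

(** The truncated integrals are dominated by those of the absolute value, which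
    reduces everything to an absolutely convergent transform. *)
Lemma abse_laplace_le f y : has_laplace f -> 0 < y ->
  (`|laplace f y| <= abs_laplace f y)%E.
Proof.
move=> [mf hf] y0; have [_ [l hl]] := hf _ y0.
rewrite /laplace (cvg_lim _ hl)//.
have hl' : `|laplace_trunc f y N|%E @[N --> +oo] --> `|l%:E|%E.
  exact: cvg_abse.
rewrite -(cvg_lim _ hl')//; apply: lime_le.
  by apply/cvg_ex; eexists; exact: hl'.
apply: nearW => N; rewrite /laplace_trunc.
have sub : `]0%R, N[%classic `<=` @Rpos R.
  by move=> x; rewrite /= in_itv/= => /andP[x0 _]; apply/RposP.
have mexp : measurable_fun (@Rpos R) (fun x => f x * expR (- (x * y))).
  apply: measurable_funM => //.
  by apply: measurable_funTS; exact: measurable_expMr.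
apply: (@le_trans _ _
    (\int[mu]_(x in `]0%R, N[) `|(f x * expR (- (x * y)))%:E|)%E).
  apply: le_abse_integral => //; apply/measurable_EFinP.
  by apply: (measurable_funS _ sub mexp); exact: measurable_Rpos.
have -> : (fun x => `|(f x * expR (- (x * y)))%:E|%E) =
    (fun x => (`|f x| * expR (- (x * y)))%:E).
  by apply/funext => x /=; rewrite normrM (ger0_norm (expR_ge0 _)).
apply: ge0_subset_integral => //; first exact: measurable_Rpos.
apply/measurable_EFinP; apply: measurable_funM.
  exact: measurableT_comp.
by apply: measurable_funTS; exact: measurable_expMr.
Qed.

Lemma hoelder_Rpos (F G : R -> R) r : 1 < r ->
  measurable_fun (@Rpos R) F -> measurable_fun (@Rpos R) G ->
  (forall x, 0 < x -> 0 <= F x) -> (forall x, 0 < x -> 0 <= G x) ->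
  (\int[mu]_(x in Rpos) (F x * G x)%:E <=
   (\int[mu]_(x in Rpos) (F x `^ r)%:E) `^ r^-1 *
   (\int[mu]_(x in Rpos) (G x `^ (1 - r^-1)^-1)%:E) `^ (1 - r^-1))%E.
Proof.
move=> r1 mF mG F0 G0; have r0 : 0 < r by lra.
have ri1 : r^-1 < 1 by rewrite invf_lt1.
have s0 : 0 < (1 - r^-1)^-1 by rewrite invr_gt0; lra.
have mres (h : R -> R) : measurable_fun (@Rpos R) h ->
    measurable_fun setT (h \_ Rpos).
  move=> mh; apply/(measurable_restrictT _ _).1 => //; exact: measurable_Rpos.
have := hoelder mu (mres _ mF) (mres _ mG) r0 s0.
rewrite invrK subrKC => /(_ erefl).
have NE (h : R -> R) z : 0 < z -> (forall x, 0 < x -> 0 <= h x) ->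
    ('N[mu]_z%:E[EFin \o (h \_ Rpos)] =
     (\int[mu]_(x in Rpos) (h x `^ z)%:E) `^ z^-1)%E.
  move=> z0 h0; rewrite -restrict_EFin -/(Lnorm_pos z%:E (EFin \o h)).
  rewrite Lnorm_posE//; congr (_ `^ _)%E; apply: eq_integral => x.
  by rewrite inE => /RposP x0; rewrite /= ger0_norm// h0.
rewrite NE// NE// invrK; apply: le_trans.
have -> : ((F \_ Rpos) \* (G \_ Rpos))%R = (F \* G)%R \_ Rpos.
  by apply/funext => x /=; rewrite !patchE; case: ifP => //; rewrite mul0r.
rewrite NE//; last by move=> x x0; rewrite mulr_ge0 ?F0 ?G0.
rewrite invr1 poweRe1; last first.
  by apply: integral_ge0 => x _; rewrite lee_fin powR_ge0.
rewrite le_eqVlt; apply/orP; left; apply/eqP; apply: eq_integral => x.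
rewrite inE => /RposP x0; rewrite powRr1// mulr_ge0 ?F0 ?G0//.
Qed.

(** This is [y^(-a)] times the multiplicative convolution of [x * H x] with
    [t^a e^(-t)]; for [H x = (x^gamma |f x|)^p], the function [x * H x] is the
    [F^p] of the introduction. *)
Definition kernel_integral a H y : \bar R :=
  (\int[mu]_(x in Rpos) (H x * (x `^ a * expR (- (x * y))))%:E)%E.

(** Hoelder's inequality for [|f x| e^(-x y)], where [e^(-x y)] and the powers
    of [x] are distributed so that the factor without [f] is the Gamma
    integral. For [r = 1] that factor is raised to the power [0], and the bound
    is an equality even if the Gamma integral diverges. *)
Lemma abs_laplace_jensen f r gamma y (a := 1 - r^-1 - gamma)
    (H := fun x => (x `^ gamma * `|f x|) `^ r) :
  1 <= r -> measurable_fun (@Rpos R) f ->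
  (abs_laplace f y <=
   (\int[mu]_(x in Rpos) (x `^ (a - 1) * expR (- (x * y)))%:E) `^ (1 - r^-1) *
   kernel_integral a H y `^ r^-1)%E.
Proof.
rewrite le_eqVlt => /orP[/eqP r1|r1] mf.
  rewrite -r1 invr1 subrr poweRe0 mul1e poweRe1; last first.
    apply: integral_ge0 => x _.
    by rewrite lee_fin !mulr_ge0 ?powR_ge0 ?expR_ge0.
  rewrite le_eqVlt; apply/orP; left; apply/eqP; apply: eq_integral => x.
  rewrite inE => /RposP x0; rewrite /H -r1 powRr1 ?mulr_ge0 ?powR_ge0//.
  rewrite /a -r1 invr1 subrr sub0r; congr EFin; rewrite powRN.
  by field; rewrite gt_eqF// powR_gt0.
have r0 : 0 < r by lra.
have ri1 : r^-1 < 1 by rewrite invf_lt1.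
pose F x := x `^ gamma * `|f x| * (x `^ (a / r) * expR (- (x * y) / r)).
pose G x := (x `^ (a - 1) * expR (- (x * y))) `^ (1 - r^-1).
have mpow c : measurable_fun (@Rpos R) (fun x => x `^ c).
  by apply: measurable_funTS.
have mexp c : measurable_fun (@Rpos R) (fun x => expR (- (x * y) * c)).
  apply: measurable_funTS; apply: measurableT_comp => //.
  apply: measurable_funM => //; apply: measurableT_comp => //.
  exact: measurable_funM.
have F0 x : 0 < x -> 0 <= F x.
  by move=> x0; rewrite /F !mulr_ge0 ?powR_ge0 ?expR_ge0.
have G0 x : 0 < x -> 0 <= G x by move=> x0; exact: powR_ge0.
have mF : measurable_fun (@Rpos R) F.
  apply: measurable_funM; apply: measurable_funM => //.
  exact: measurableT_comp.
have mG : measurable_fun (@Rpos R) G.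
  apply: (measurableT_comp (measurable_powR _)) => //.
  apply: measurable_funM => //.
  by apply: measurable_funTS; exact: measurable_expMr.
have := hoelder_Rpos _ _ _ r1 mF mG F0 G0; rewrite muleC.
have expK x : expR (- (x * y) / r) * expR (- (x * y) * (1 - r^-1))
    = expR (- (x * y)).
  by rewrite -expRD; congr expR; field; rewrite gt_eqF.
(* The powers of [x] cancel because [gamma + a/r + (a - 1)(1 - 1/r) = 0]. *)
have -> : (\int[mu]_(x in Rpos) (F x * G x)%:E = abs_laplace f y)%E.
  apply: eq_integral => x; rewrite inE => /RposP x0; congr EFin.
  rewrite /F /G powRM ?powR_ge0 ?expR_ge0// -powRrM -expRM -expK.
  have xx : x `^ gamma * x `^ (a / r) * x `^ ((a - 1) * (1 - r^-1)) = 1.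
    have xn c : (c == 0) ==> (x != 0) by rewrite (gt_eqF x0) implybT.
    do 2 (rewrite -powRD; last exact: xn).
    rewrite -[RHS](powRr0 x); congr (_ `^ _); rewrite /a.
    by field; rewrite gt_eqF.
  by rewrite -[RHS]mul1r -[X in _ = X * _]xx; ring.
have -> : (\int[mu]_(x in Rpos) (F x `^ r)%:E = kernel_integral a H y)%E.
  apply: eq_integral => x; rewrite inE => /RposP x0; congr EFin.
  rewrite /F powRM ?mulr_ge0 ?powR_ge0 ?expR_ge0//; congr (_ * _).
  rewrite powRM ?powR_ge0 ?expR_ge0// -powRrM -expRM.
  by rewrite !divfK ?gt_eqF.
suff -> : (\int[mu]_(x in Rpos) (G x `^ (1 - r^-1)^-1)%:E =
    \int[mu]_(x in Rpos) (x `^ (a - 1) * expR (- (x * y)))%:E)%E by [].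
apply: eq_integral => x; rewrite inE => /RposP x0; congr EFin.
rewrite /G -powRrM mulfV ?powRr1 ?mulr_ge0 ?powR_ge0 ?expR_ge0//.
by rewrite gt_eqF//; lra.
Qed.

Lemma kernel_integral_le a M H y : 0 < y -> 0 <= M ->
  (forall x, 0 <= H x) -> measurable_fun (@Rpos R) H ->
  (forall t, 0 < t -> t `^ a * expR (- t) <= M) ->
  (kernel_integral a H y <=
   (M * y `^ (- a))%:E * \int[mu]_(x in Rpos) (H x)%:E)%E.
Proof.
move=> y0 M0 H0 mH hM.
rewrite -ge0_integralZl//; last 4 first.
- exact: measurable_Rpos.
- exact/measurable_EFinP.
- by move=> x _; rewrite lee_fin.
- by rewrite lee_fin mulr_ge0 ?powR_ge0.
apply: ge0_le_integral_any => x /RposP x0.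
  by rewrite lee_fin !mulr_ge0 ?powR_ge0 ?expR_ge0.
rewrite -EFinM lee_fin mulrC ler_wpM2r//.
rewrite powRN ler_pdivlMr ?powR_gt0// mulrAC -powRM ?(ltW x0) ?(ltW y0)//.
by apply: hM; rewrite mulr_gt0.
Qed.

(** The kernel is symmetric in [x] and [y], so after exchanging the integrals
    the same Gamma bound applies in the variable [y], and its [x^(-a)] cancels
    the [x^a] of the kernel. *)
Lemma integral_kernel_integral_le a K H : 0 <= K ->
  (forall x, 0 <= H x) -> measurable_fun (@Rpos R) H ->
  (forall y, 0 < y -> (\int[mu]_(x in Rpos) (x `^ (a - 1) * expR (- (x * y)))%:E
    <= (K * y `^ (- a))%:E)%E) ->
  (\int[mu]_(y in Rpos) ((y `^ (a - 1))%:E * kernel_integral a H y)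
   <= K%:E * \int[mu]_(x in Rpos) (H x)%:E)%E.
Proof.
move=> K0 H0 mH hK.
(* Everything is extended by 0 to apply Tonelli's theorem on the plane. *)
pose H' := H \_ Rpos.
pose P c : R -> R := (fun x => x `^ c) \_ Rpos.
have mP c : measurable_fun setT (P c).
  apply/(measurable_restrictT _ _).1; first exact: measurable_Rpos.
  exact: measurable_funTS.
have mH' : measurable_fun setT H'.
  by apply/(measurable_restrictT _ _).1 => //; exact: measurable_Rpos.
pose k (z : R * R) : \bar R :=
  (H' z.1 * P a z.1 * P (a - 1) z.2 * expR (- (z.1 * z.2)))%:E.
have mk : measurable_fun setT k.
  apply/measurable_EFinP; apply: measurable_funM; [apply: measurable_funM|].
  - apply: measurable_funM; exact: measurableT_comp.
  - exact: measurableT_comp.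
  - apply: measurableT_comp => //; apply: measurableT_comp => //.
    exact: measurable_funM.
have k0 z : (0 <= k z)%E.
  rewrite lee_fin /k !mulr_ge0 ?expR_ge0// /H' /P patchE; case: ifP => //;
    rewrite powR_ge0//.
have -> : (\int[mu]_(y in Rpos) ((y `^ (a - 1))%:E * kernel_integral a H y) =
    \int[mu]_y \int[mu]_x k (x, y))%E.
  rewrite integral_mkcond; apply: eq_integral => y _; rewrite patchE.
  case: ifPn => [|yR]; last first.
    rewrite integral0_eq// => x _.
    by rewrite /k /= /P [X in _ * X * _]patchE (negbTE yR) mulr0 mul0r.
  move=> yR; rewrite -ge0_integralZl//; last 4 first.
  - exact: measurable_Rpos.
  - apply/measurable_EFinP; apply: measurable_funM => //.
    apply: measurable_funM; apply: measurable_funTS => //.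
    exact: measurable_expMr.
  - by move=> x _; rewrite lee_fin !mulr_ge0 ?powR_ge0 ?expR_ge0.
  - by rewrite lee_fin powR_ge0.
  rewrite integral_mkcond; apply: eq_integral => x _; rewrite patchE.
  rewrite /k/= /H' /P !patchE yR.
  by case: ifPn => _; rewrite ?mul0r// -EFinM; congr EFin; ring.
have -> : (\int[mu]_y \int[mu]_x k (x, y) = \int[mu]_x \int[mu]_y k (x, y))%E.
  by apply/esym; exact: fubini_tonelli.
rewrite -ge0_integralZl//; last 3 first.
- exact: measurable_Rpos.
- exact/measurable_EFinP.
- by move=> x _; rewrite lee_fin.
rewrite [leRHS]integral_mkcond; apply: ge0_le_integral_any => x _.
  exact: integral_ge0.
rewrite patchE; case: ifPn => xR; last first.
  rewrite integral0_eq// => y _.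
  by rewrite /k /= /H' patchE (negbTE xR) !mul0r.
have x0 : 0 < x by move: xR; rewrite inE => /RposP.
have -> : (\int[mu]_y k (x, y) = (H x * x `^ a)%:E *
    \int[mu]_(y in Rpos) (y `^ (a - 1) * expR (- (y * x)))%:E)%E.
  rewrite -ge0_integralZl//; last 4 first.
  - exact: measurable_Rpos.
  - apply/measurable_EFinP.
    apply: measurable_funM; apply: measurable_funTS => //.
    exact: measurable_expMr.
  - by move=> y _; rewrite lee_fin mulr_ge0 ?powR_ge0 ?expR_ge0.
  - by rewrite lee_fin mulr_ge0 ?powR_ge0.
  rewrite [RHS]integral_mkcond; apply: eq_integral => y _.
  rewrite [RHS]patchE /k /= /H' /P patchE xR patchE xR patchE.
  case: ifPn => _; last by rewrite mulr0 mul0r.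
  by rewrite -EFinM (mulrC y x) mulrA.
apply: (le_trans (lee_wpmul2l _ (hK x x0))).
  by rewrite lee_fin mulr_ge0 ?powR_ge0.
rewrite -!EFinM lee_fin powRN le_eqVlt; apply/orP; left; apply/eqP.
by field; rewrite gt_eqF// powR_gt0.
Qed.

End kernel.

(** * Sufficiency *)

Section sufficiency.
Context {R : realType}.
Local Notation mu := (@lebesgue_measure R).
Implicit Types (p q : \bar R) (a beta gamma r s x y : R) (f h H : R -> R).

Lemma powR_expRN_bounded a : 0 <= a ->
  exists2 M : R, 0 < M & forall t, 0 < t -> t `^ a * expR (- t) <= M.
Proof.
rewrite le_eqVlt => /predU1P[<-|a0].
  exists 1 => // t t0; rewrite powRr0 mul1r -expR0 ler_expR; lra.
exists (a `^ a); first exact: powR_gt0.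
by move=> t t0; rewrite expRN ler_pdivrMr ?expR_gt0// powR_le_expR// ltW.
Qed.

Definition weighted_power r gamma f x : R := (x `^ gamma * `|f x|) `^ r.

Lemma Lnorm_pos_weighted r gamma f : 0 < r ->
  (Lnorm_pos r%:E (fun x => (x `^ gamma * f x)%:E) =
   (\int[mu]_(x in Rpos) (weighted_power r gamma f x)%:E) `^ r^-1)%E.
Proof.
move=> r0; rewrite Lnorm_posE//; congr (_ `^ _)%E; apply: eq_integral => x _.
by rewrite /= normrM (ger0_norm (powR_ge0 _ _)).
Qed.

Lemma measurable_weighted_power r gamma f : measurable_fun (@Rpos R) f ->
  measurable_fun (@Rpos R) (weighted_power r gamma f).
Proof.
move=> mf; apply: (measurableT_comp (measurable_powR _)) => //.
apply: measurable_funM; first exact: measurable_funTS.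
exact: measurableT_comp.
Qed.

(** Treats [a > 0] and [r = 1] together: in the second case the exponent
    [1 - 1/r] is zero and the integral may be infinite. *)
Lemma gamma_factor_le r a : 1 <= r -> 0 < a \/ r = 1 ->
  exists2 K : R, 0 < K & forall y, 0 < y ->
  ((\int[mu]_(x in Rpos) (x `^ (a - 1) * expR (- (x * y)))%:E) `^ (1 - r^-1)
    <= ((K * y `^ (- a)) `^ (1 - r^-1))%:E)%E.
Proof.
move=> r1 [a0|->]; last first.
  by exists 1 => // y y0; rewrite invr1 subrr poweRe0 powRr0.
have [K K0 hK] := gamma_integral_le _ a0; exists K => // y y0.
have r'0 : 0 <= 1 - r^-1 by rewrite subr_ge0 invf_le1//; lra.
rewrite -poweR_EFin; apply: gt0_ler_poweR => //.
- rewrite in_itv/= leey andbT; apply: integral_ge0 => x _.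
  by rewrite lee_fin mulr_ge0 ?powR_ge0 ?expR_ge0.
- by rewrite in_itv/= leey andbT lee_fin mulr_ge0 ?powR_ge0 ?ltW.
- exact: hK.
Qed.

(** This is the [L_r] to [L_oo] bound: the weighted Hoelder inequality with
    the kernel replaced by its maximum. *)
Lemma abs_laplace_decay r gamma (a := 1 - r^-1 - gamma) :
  1 <= r -> 0 < a \/ r = 1 /\ 0 <= a -> exists2 D : R, 0 < D &
  forall f, measurable_fun (@Rpos R) f -> forall y, 0 < y ->
  (abs_laplace f y <= (D * y `^ (- a))%:E *
    (\int[mu]_(x in Rpos) (weighted_power r gamma f x)%:E) `^ r^-1)%E.
Proof.
move=> r1 ha.
have a0 : 0 <= a by case: ha => [/ltW|[]].
have [K K0 hK] : exists2 K : R, 0 < K & forall y, 0 < y ->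
    ((\int[mu]_(x in Rpos) (x `^ (a - 1) * expR (- (x * y)))%:E) `^ (1 - r^-1)
      <= ((K * y `^ (- a)) `^ (1 - r^-1))%:E)%E.
  by apply: gamma_factor_le => //; case: ha => [|[]]; [left|right].
have [M M0 hM] := powR_expRN_bounded _ a0.
have ri0 : 0 <= r^-1 by rewrite invr_ge0; lra.
exists (K `^ (1 - r^-1) * M `^ r^-1); first by rewrite mulr_gt0 ?powR_gt0.
move=> f mf y y0; apply: (le_trans (abs_laplace_jensen _ _ gamma y r1 mf)).
have H0 x : 0 <= weighted_power r gamma f x by exact: powR_ge0.
have mH := measurable_weighted_power r gamma _ mf.
have B0 : (0 <= kernel_integral a (weighted_power r gamma f) y)%E.
  by apply: integral_ge0 => x _; rewrite lee_fin !mulr_ge0 ?powR_ge0 ?expR_ge0.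
have W0 : (0 <= \int[mu]_(x in Rpos) (weighted_power r gamma f x)%:E)%E.
  by apply: integral_ge0 => x _; rewrite lee_fin.
apply: (@le_trans _ _ (((K * y `^ (- a)) `^ (1 - r^-1))%:E *
   ((M * y `^ (- a))%:E * \int[mu]_(x in Rpos) (weighted_power r gamma f x)%:E)
      `^ r^-1)%E).
  apply: lee_pmul => //; [exact: poweR_ge0|exact: poweR_ge0|exact: hK|].
  apply: gt0_ler_poweR => //.
  - by rewrite in_itv/= leey andbT.
  - by rewrite in_itv/= leey andbT mule_ge0// lee_fin mulr_ge0 ?powR_ge0 ?ltW.
  - by apply: kernel_integral_le => //; exact: ltW.
have yM0 : 0 <= M * y `^ (- a) by rewrite mulr_ge0 ?powR_ge0 ?ltW.
rewrite poweRM ?lee_fin// poweR_EFin muleA -EFinM.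
rewrite le_eqVlt; apply/orP; left; apply/eqP; congr (_ %:E * _)%E.
rewrite !powRM ?powR_ge0 ?(ltW M0) ?(ltW K0)// mulrACA; congr (_ * _).
by rewrite -powRD ?subrK ?powRr1 ?powR_ge0// oner_eq0.
Qed.

Lemma laplace_bounded_pointwise r beta gamma :
  1 <= r -> - beta = 1 - r^-1 - gamma ->
  0 < - beta \/ r = 1 /\ 0 <= - beta ->
  laplace_bounded r%:E +oo beta gamma.
Proof.
move=> r1 bE; rewrite bE => ha; have r0 : 0 < r by lra.
have [D D0 hD] := abs_laplace_decay _ _ r1 ha.
exists D => // f hf; rewrite /laplace_ineq Lnorm_pos_weighted//.
have W0 : (0 <= D%:E *
    (\int[mu]_(x in Rpos) (weighted_power r gamma f x)%:E) `^ r^-1)%E.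
  by rewrite mule_ge0 ?poweR_ge0// lee_fin ltW.
apply/Lnorm_posyP; apply: nearW => y; rewrite patchE.
case: ifPn => [|_]; last by rewrite abse0.
rewrite inE => /RposP y0; rewrite abseM/= ger0_norm ?powR_ge0//.
have yb0 : (0 <= (y `^ (- beta))%:E)%E by rewrite lee_fin powR_ge0.
have hL := le_trans (abse_laplace_le _ _ hf y0) (hD f hf.1 y y0).
apply: (le_trans (lee_wpmul2l yb0 hL)).
rewrite muleA -EFinM mulrCA bE -powRD; last by rewrite (gt_eqF y0) implybT.
by rewrite subrr powRr0 mulr1.
Qed.

(** For [p = oo] the pointwise bound [|f x| <= N x^(-gamma)] is integrated
    against [e^(-x y)], giving the Gamma integral directly. *)
Lemma laplace_bounded_sup beta gamma :
  - beta = 1 - gamma -> 0 < - beta -> laplace_bounded +oo +oo beta gamma.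
Proof.
move=> bE; rewrite bE => a0.
have [K K0 hK] := gamma_integral_le _ a0.
exists K => // f hf; rewrite /laplace_ineq.
set N := Lnorm_pos _ (fun x => (x `^ gamma * f x)%:E).
have N0 : (0 <= N)%E by exact: Lnorm_ge0.
have KN0 : (0 <= K%:E * N)%E by rewrite mule_ge0// lee_fin ltW.
have := (Lnorm_posyP (fun x => (x `^ gamma * f x)%:E) N).1 (lexx _) => hN.
apply/Lnorm_posyP; apply: nearW => y; rewrite patchE.
case: ifPn => [|_]; last by rewrite abse0.
rewrite inE => /RposP y0; rewrite abseM/= ger0_norm ?powR_ge0//.
have yb0 : (0 <= (y `^ (- beta))%:E)%E by rewrite lee_fin powR_ge0.
have hU : (abs_laplace f y <= N * (K * y `^ (- (1 - gamma)))%:E)%E.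
  apply: le_trans (lee_wpmul2l N0 (hK y y0)).
  rewrite -ge0_integralZl//; last 3 first.
  - exact: measurable_Rpos.
  - apply/measurable_EFinP.
    apply: measurable_funM; apply: measurable_funTS => //.
    exact: measurable_expMr.
  - by move=> x _; rewrite lee_fin mulr_ge0 ?powR_ge0 ?expR_ge0.
  apply: ae_ge0_le_integral => //.
  - exact: measurable_Rpos.
  - apply/measurable_EFinP; apply: measurable_funM.
      by apply: measurableT_comp => //; exact: hf.1.
    by apply: measurable_funTS; exact: measurable_expMr.
  - by move=> x _; rewrite mule_ge0// lee_fin mulr_ge0 ?powR_ge0 ?expR_ge0.
  - apply: measurable_funeM; apply/measurable_EFinP.
    apply: measurable_funM; apply: measurable_funTS => //.
    exact: measurable_expMr.
  apply: (@filterS _ _ (ae_filter_ringOfSetsType mu) _ _ _ hN) => x hx xR.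
  move: hx; rewrite patchE mem_set// => hx.
  move/RposP: xR => x0.
  have wx : (0 <= (x `^ (1 - gamma - 1) * expR (- (x * y)))%:E)%E.
    by rewrite lee_fin mulr_ge0 ?powR_ge0 ?expR_ge0.
  apply: le_trans (lee_wpmul2r wx hx).
  rewrite /= normrM (ger0_norm (powR_ge0 _ _)) lee_fin addrAC subrr add0r powRN.
  rewrite le_eqVlt; apply/orP; left; apply/eqP.
  by field; rewrite gt_eqF// powR_gt0.
have hL := le_trans (abse_laplace_le _ _ hf y0) hU.
apply: (le_trans (lee_wpmul2l yb0 hL)).
rewrite muleCA -EFinM mulrCA bE -powRD; last by rewrite (gt_eqF y0) implybT.
by rewrite subrr powRr0 mulr1 muleC.
Qed.

(** The splitting [u^s = u^(s-r) u^r] for [u = L |f| y]: the first factor uses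
    the decay bound, the second the weighted Hoelder bound, in which [b] occurs
    linearly and can be integrated in [y]. *)
Lemma interpolation_powR (beta a r s y u b w D K : R) :
  1 <= r -> r <= s -> 0 < y -> 0 <= u -> 0 <= b -> 0 <= w -> 0 < D -> 0 < K ->
  a = s^-1 - beta ->
  u <= D * y `^ (- a) * w `^ r^-1 ->
  u <= (K * y `^ (- a)) `^ (1 - r^-1) * b `^ r^-1 ->
  (y `^ (- beta) * u) `^ s <=
    y `^ (a - 1) * (D `^ (s - r) * K `^ (r - 1) * w `^ ((s - r) / r) * b).
Proof.
move=> r1 rs y0 u0 b0 w0 D0 K0 aE u1 u2.
have r0 : 0 < r by lra.
have s0 : 0 < s by lra.
have rs0 : 0 <= s - r by lra.
have Ky0 : 0 <= K * y `^ (- a) by rewrite mulr_ge0 ?powR_ge0 ?ltW.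
have Dy0 : 0 <= D * y `^ (- a) by rewrite mulr_ge0 ?powR_ge0 ?ltW.
have h1 : u `^ (s - r) <=
    D `^ (s - r) * y `^ (- a * (s - r)) * w `^ ((s - r) / r).
  have := ge0_ler_powR rs0 _ _ u1; rewrite !nnegrE mulr_ge0 ?powR_ge0//.
  move=> /(_ u0 erefl) /le_trans; apply.
  rewrite powRM ?powR_ge0// powRM ?powR_ge0 ?(ltW D0)// -!powRrM.
  by rewrite (mulrC r^-1).
have h2 : u `^ r <= K `^ (r - 1) * y `^ (- a * (r - 1)) * b.
  have := ge0_ler_powR (ltW r0) _ _ u2; rewrite !nnegrE mulr_ge0 ?powR_ge0//.
  move=> /(_ u0 erefl) /le_trans; apply.
  rewrite powRM ?powR_ge0// -!powRrM mulVf ?gt_eqF// powRr1//.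
  have -> : (1 - r^-1) * r = r - 1 by field; rewrite gt_eqF.
  by rewrite powRM ?powR_ge0 ?(ltW K0)// -!powRrM.
rewrite powRM ?powR_ge0//.
have -> : u `^ s = u `^ (s - r) * u `^ r.
  by rewrite -powRD ?subrK// gt_eqF.
have h12 := ler_pM (powR_ge0 _ _) (powR_ge0 _ _) h1 h2.
apply: (le_trans (ler_wpM2l (powR_ge0 _ _) h12)).
have -> : y `^ (a - 1) =
    (y `^ (- beta)) `^ s * y `^ (- a * (s - r)) * y `^ (- a * (r - 1)).
  have yn c : (c == 0) ==> (y != 0) by rewrite (gt_eqF y0) implybT.
  rewrite -powRrM; do 2 (rewrite -powRD; last exact: yn).
  by congr (_ `^ _); rewrite aE; field; rewrite gt_eqF.
by rewrite le_eqVlt; apply/orP; left; apply/eqP; ring.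
Qed.

Lemma laplace_bounded_finite r s beta gamma :
  1 <= r -> r <= s -> s^-1 - beta = 1 - r^-1 - gamma -> 0 < s^-1 - beta ->
  laplace_bounded r%:E s%:E beta gamma.
Proof.
move=> r1 rs bE a0; set a := s^-1 - beta in bE a0.
have r0 : 0 < r by lra.
have s0 : 0 < s by lra.
have ha : 0 < 1 - r^-1 - gamma by rewrite -bE.
have [D D0] := abs_laplace_decay _ _ r1 (or_introl ha); rewrite -bE => hD.
have [M M0 hM] := powR_expRN_bounded _ (ltW a0).
have [K K0 hK] := gamma_integral_le _ a0.
pose c0 := D `^ (s - r) * K `^ (r - 1).
have c00 : 0 < c0 by rewrite mulr_gt0 ?powR_gt0.
exists ((c0 * K) `^ s^-1); first by rewrite powR_gt0// mulr_gt0.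
move=> f hf; rewrite /laplace_ineq Lnorm_pos_weighted//.
set H := weighted_power r gamma f.
have H0 x : 0 <= H x by exact: powR_ge0.
have mH := measurable_weighted_power r gamma _ hf.1.
have W0 : (0 <= \int[mu]_(x in Rpos) (H x)%:E)%E.
  by apply: integral_ge0 => x _; rewrite lee_fin.
have C0 : 0 < (c0 * K) `^ s^-1 by rewrite powR_gt0// mulr_gt0.
have ri0 : 0 < r^-1 by rewrite invr_gt0.
have [Woo|Woo] := eqVneq (\int[mu]_(x in Rpos) (H x)%:E)%E +oo%E.
  by rewrite Woo poweRyr ?gt_eqF// gt0_muley ?lte_fin// leey.
have Wfin : (\int[mu]_(x in Rpos) (H x)%:E)%E \is a fin_num.
  by rewrite ge0_fin_numE// ltey.
move: (hD f hf.1) (fun y (y0 : 0 < y) =>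
  kernel_integral_le a M H y y0 (ltW M0) H0 mH hM).
have := integral_kernel_integral_le a K.
rewrite -(fineK Wfin) -/H; set w := fine _ => tonelli hU hB.
have w0 : 0 <= w by exact: fine_ge0.
pose c := c0 * w `^ ((s - r) / r).
have c0' : 0 <= c by rewrite mulr_ge0 ?powR_ge0 ?ltW.
rewrite Lnorm_posE// poweR_EFin -EFinM.
have -> : (c0 * K) `^ s^-1 * w `^ r^-1 = (K * (c * w)) `^ s^-1.
  rewrite /c -mulrA.
  have -> : w `^ ((s - r) / r) * w = w `^ (s / r).
    rewrite -{2}(powRr1 w0) -powRD.
      by congr (_ `^ _); field; rewrite gt_eqF.
    have -> : (s - r) / r + 1 = s / r by field; rewrite gt_eqF.
    by rewrite gt_eqF// divr_gt0.
  rewrite mulrA (mulrC K) [RHS]powRM ?powR_ge0 ?(mulr_ge0 (ltW c00) (ltW K0))//.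
  congr (_ * _); rewrite -powRrM; congr (_ `^ _).
  by field; rewrite !gt_eqF.
rewrite -poweR_EFin; apply: gt0_ler_poweR.
- by rewrite invr_ge0 ltW.
- rewrite in_itv/= leey andbT; apply: integral_ge0 => x _; exact: poweR_ge0.
- by rewrite in_itv/= leey andbT lee_fin mulr_ge0 ?(ltW K0)// mulr_ge0.
have cH0 x : 0 <= c * H x by rewrite mulr_ge0.
have mcH : measurable_fun (@Rpos R) (fun x => c * H x).
  exact: measurable_funM.
have cW : (\int[mu]_(x in Rpos) (c * H x)%:E)%E = (c * w)%:E.
  under eq_integral do rewrite EFinM.
  rewrite ge0_integralZl ?lee_fin//; last 3 first.
  - exact: measurable_Rpos.
  - exact/measurable_EFinP.
  - by move=> x _; rewrite lee_fin.
  by rewrite [RHS]EFinM; congr (_ * _)%E; rewrite /w fineK.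
have := tonelli _ (ltW K0) cH0 mcH hK; rewrite cW -EFinM.
apply: le_trans; apply: ge0_le_integral_any => y /RposP y0.
  exact: poweR_ge0.
(* The constant is moved inside [kernel_integral], so that pulling it out of
   an integral only involves the explicit integrand. *)
have Bc : kernel_integral a (fun x => c * H x) y =
    (c%:E * kernel_integral a H y)%E.
  rewrite -ge0_integralZl//; last 3 first.
  - exact: measurable_Rpos.
  - apply/measurable_EFinP; apply: measurable_funM => //.
    apply: measurable_funM; apply: measurable_funTS => //.
    exact: measurable_expMr.
  - by move=> x _; rewrite lee_fin !mulr_ge0 ?powR_ge0 ?expR_ge0.
  by apply: eq_integral => x _; rewrite -EFinM -mulrA.
have B0 : (0 <= kernel_integral a H y)%E.
  by apply: integral_ge0 => x _; rewrite lee_fin !mulr_ge0 ?powR_ge0 ?expR_ge0.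
have U0 : (0 <= abs_laplace f y)%E.
  by apply: integral_ge0 => x _; rewrite lee_fin !mulr_ge0 ?powR_ge0 ?expR_ge0.
have Bfin : kernel_integral a H y \is a fin_num.
  by rewrite ge0_fin_numE// (le_lt_trans (hB y y0))// -EFinM ltry.
have Ufin : abs_laplace f y \is a fin_num.
  by rewrite ge0_fin_numE// (le_lt_trans (hU y y0))// poweR_EFin -EFinM ltry.
have hJ := abs_laplace_jensen f r gamma y r1 hf.1.
have {}hJ : (abs_laplace f y <=
    ((K * y `^ (- a)) `^ (1 - r^-1))%:E * kernel_integral a H y `^ r^-1)%E.
  apply: (le_trans hJ); rewrite -bE; apply: lee_wpmul2r; first exact: poweR_ge0.
  have r'0 : 0 <= 1 - r^-1 by rewrite subr_ge0 invf_le1.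
  rewrite -poweR_EFin; apply: gt0_ler_poweR => //.
  - rewrite in_itv/= leey andbT; apply: integral_ge0 => x _.
    by rewrite lee_fin mulr_ge0 ?powR_ge0 ?expR_ge0.
  - by rewrite in_itv/= leey andbT lee_fin mulr_ge0 ?powR_ge0 ?ltW.
  - exact: hK.
have := hU y y0; move: hJ; rewrite Bc.
have := abse_laplace_le _ _ hf y0.
rewrite -(fineK Ufin) -(fineK Bfin); set u := fine _; set b := fine _.
have u0 : 0 <= u by exact: fine_ge0.
have b0 : 0 <= b by exact: fine_ge0.
rewrite !poweR_EFin -!EFinM !lee_fin => Lu u2 u1.
have := @interpolation_powR beta a r s y u b w D K r1 rs y0 u0 b0 w0 D0 K0
  erefl u1 u2.
rewrite -lee_fin => /(le_trans _); apply.
rewrite -[leRHS]poweR_EFin; apply: gt0_ler_poweR.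
- exact: ltW.
- by rewrite in_itv/= leey andbT abse_ge0.
- by rewrite in_itv/= leey andbT lee_fin mulr_ge0 ?powR_ge0.
by rewrite abseM/= ger0_norm ?powR_ge0// EFinM lee_wpmul2l// lee_fin powR_ge0.
Qed.

End sufficiency.

(** * The characterization *)

Section characterization.
Context {R : realType}.
Implicit Types (p q : \bar R) (beta gamma : R).

(** Equality [1/p = 1 + 1/q] is only possible for [p = 1] and [q = oo]. *)
Lemma inv_exp_lt1D p q : (1 <= p)%E -> (p <= q)%E -> (p, q) <> (1%E, +oo%E) ->
  inv_exp p < 1 + inv_exp q.
Proof.
case: p => [r|_|//]; last first.
  by rewrite leye_eq => /eqP -> _; rewrite inv_expy addr0.
rewrite lee_fin => r1; have r0 : 0 < r by lra.
rewrite inv_expE ?gt_eqF//.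
have ri1 : r^-1 <= 1 by rewrite invf_le1.
case: q => [s| _ rq|//].
  rewrite lee_fin => rs _; have s0 : 0 < s by lra.
  rewrite inv_expE ?gt_eqF//.
  by have : 0 < s^-1 by [rewrite invr_gt0]; lra.
rewrite inv_expy addr0 invf_lt1// lt_neqAle r1 andbT.
by apply/eqP => rE; apply: rq; rewrite -rE.
Qed.

Lemma laplace_boundedP p q beta gamma :
  (1 <= p)%E -> (p <= q)%E -> (p, q) <> (1%E, +oo%E) ->
  laplace_bounded p q beta gamma <->
  beta < inv_exp q /\ inv_exp q - beta = 1 - inv_exp p - gamma.
Proof.
move=> p1 pq npq; have q1 := le_trans p1 pq; split.
  move=> bpq; split; last exact: laplace_bounded_scaling bpq.
  by apply: laplace_bounded_beta_lt bpq => //; exact: inv_exp_lt1D.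
move=> [bq bE]; have a0 : 0 < inv_exp q - beta by rewrite subr_gt0.
case: p p1 pq npq bE => [r|_|//]; last first.
  rewrite leye_eq => /eqP qy _; move: a0; rewrite qy inv_expy !sub0r subr0.
  by move=> a0 bE; exact: laplace_bounded_sup.
rewrite lee_fin => r1 rq _; have r0 : 0 < r by lra.
rewrite inv_expE ?gt_eqF//.
case: q q1 rq bq a0 => [s _| _ _|//].
  rewrite lee_fin => rs _; have s0 : 0 < s by lra.
  by rewrite inv_expE ?gt_eqF// => a0 bE; exact: laplace_bounded_finite.
rewrite inv_expy !sub0r => _ a0 bE.
by apply: laplace_bounded_pointwise => //; left.
Qed.

Lemma laplace_bounded1yP beta gamma :
  laplace_bounded 1%E +oo%E beta gamma <-> beta = gamma /\ beta <= 0.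
Proof.
have inv1 : inv_exp (1%E : \bar R) = 1 by rewrite inv_expE ?invr1 ?oner_eq0.
split => [b1y|[-> g0]].
  have := laplace_bounded_scaling _ _ _ _ (lexx _) (leey _) b1y.
  have := laplace_bounded_beta_le _ _ _ _ (lexx _) (leey _) b1y.
  by rewrite inv_expy inv1 => b0 bE; split => //; lra.
apply: laplace_bounded_pointwise => //; first by rewrite invr1; lra.
by right; split => //; lra.
Qed.

End characterization.

Theorem corollary5p6 (R : realType) :
  (forall p q : \bar R,
    (1 <= p)%E -> (p <= q)%E -> (p, q) <> (1%E, +oo%E) ->
    forall beta gamma : R,
      (laplace_bounded p q beta gamma <->
        beta < inv_exp q /\
        beta = gamma + inv_exp q - inv_exp (hoelder_conjugate p)) /\
      ((beta < inv_exp q /\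
        beta = gamma + inv_exp q - inv_exp (hoelder_conjugate p)) <->
       (gamma < inv_exp (hoelder_conjugate p) /\
        gamma = beta - inv_exp q + inv_exp (hoelder_conjugate p)))) /\
  (forall beta gamma : R,
    laplace_bounded 1%E +oo%E beta gamma <-> beta = gamma /\ beta <= 0).
Proof.
split; last exact: laplace_bounded1yP.
move=> p q p1 pq npq beta gamma; rewrite inv_exp_hoelder_conjugate//.
split; last by split=> -[? ?]; split; lra.
have bP := laplace_boundedP _ _ beta gamma p1 pq npq.
split=> [/bP[bq bE]|[bq bE]]; first by split; lra.
by apply/bP; split; lra.
Qed.
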